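(* Let $G^{\varphi}$ be a connected complex unit gain graph with underlying graph $G$. Then (a) $m(G)-c(G)\leq p(G^{\varphi})\leq m(G)+c(G)$; (b) $m(G)-c(G)\leq n(G^{\varphi})\leq m(G)+c(G)$.
   Context: All graphs are finite and simple (no loops or multiple edges). A complex unit gain graph $G^{\varphi}$ consists of a graph $G$ (the underlying graph) with vertices $v_1,\dots,v_n$ and a function $\varphi$ assigning to each oriented edge $e_{ij}$ (from $v_i$ to $v_j$, where $v_iv_j\in E(G)$; both orientations of each edge are considered) a number $\varphi(e_{ij})\in\mathbb{T}=\{z\in\mathbb{C}:|z|=1\}$ such that $\varphi(e_{ij})=\varphi(e_{ji})^{-1}=\overline{\varphi(e_{ji})}$. Its adjacency matrix $A(G^{\varphi})$ is the $n\times n$ Hermitian matrix with $(i,j)$ entry $\varphi(e_{ij})$ if $v_iv_j\in E(G)$ and $0$ otherwise. $p(G^{\varphi})$ and $n(G^{\varphi})$ denote the numbers of positive and negative eigenvalues of $A(G^{\varphi})$, counted with multiplicity. $m(G)$ is the matching number of $G$ (maximum number of pairwise disjoint edges). $c(G)=|E(G)|-|V(G)|+\omega(G)$ is the cyclomatic number, where $\omega(G)$ is the number of connected components of $G$. $G^{\varphi}$ is called connected if $G$ is. *)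

(* Defs.v *)
From mathcomp Require Import all_boot all_order all_algebra.
From mathcomp Require Import reals complex.

Set Implicit Arguments.
Unset Strict Implicit.
Unset Printing Implicit Defensive.

Import Order.TTheory GRing.Theory Num.Theory.
Local Open Scope ring_scope.

Record simple_graph (n : nat) := SimpleGraph {
  adj :> rel 'I_n;
  adj_sym : symmetric adj;
  adj_irr : irreflexive adj
}.

Definition edges n (G : simple_graph n) : {set {set 'I_n}} :=
  [set [set i; j] | i in 'I_n, j in 'I_n & adj G i j].

(* No vertex is required, so the edgeless graph on 'I_0 counts as connected. *)
Definition connected n (G : simple_graph n) : Prop :=
  forall i j : 'I_n, connect (adj G) i j.

Definition num_components n (G : simple_graph n) : nat := n_comp (adj G) 'I_n.

Definition is_matching n (G : simple_graph n) (M : {set {set 'I_n}}) : bool :=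
  (M \subset edges G) && trivIset M.

Definition matching_number n (G : simple_graph n) : nat :=
  \max_(M : {set {set 'I_n}} | is_matching G M) #|M|.

(* An integer, so that the subtraction is not truncated. *)
Definition cyclomatic n (G : simple_graph n) : int :=
  #|edges G|%:Z - n%:Z + (num_components G)%:Z.

(* The gain of the oriented edge from i to j is [gain i j]; its values on
   non-adjacent pairs are unconstrained and never used. *)
Record gain_graph (R : realType) (n : nat) := GainGraph {
  ugraph : simple_graph n;
  gain : 'I_n -> 'I_n -> R[i];
  gain_unit : forall i j, adj ugraph i j -> `|gain i j| = 1;
  gain_inv : forall i j, adj ugraph i j -> gain i j = (gain j i)^-1
}.

Definition adjmx (R : realType) n (G : gain_graph R n) : 'M[R[i]]_n :=
  \matrix_(i, j) if adj (ugraph G) i j then gain G i j else 0.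

(* The roots of the characteristic polynomial, repeated according to their
   multiplicity, in some order. *)
Definition eigenvalues (R : realType) n (A : 'M[R[i]]_n) : seq R[i] :=
  sval (closed_field_poly_normal (char_poly A)).

(* On R[i], [0 < x] and [x < 0] entail that x is real. *)
Definition pos_inertia (R : realType) n (G : gain_graph R n) : nat :=
  count (fun x => 0 < x) (eigenvalues (adjmx G)).

Definition neg_inertia (R : realType) n (G : gain_graph R n) : nat :=
  count (fun x => x < 0) (eigenvalues (adjmx G)).

(* Main.v *)
Require Import Defs.
From mathcomp Require Import all_boot all_order all_algebra.
From mathcomp Require Import reals complex spectral sesquilinear zify.

(** Deleting a vertex lowers each of m, p and n by 0 or 1; an isolated vertex
    contributes to none of them; and if u is a leaf with neighbour v, then
    deleting both u and v lowers each of them by exactly 1. For the matching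
    number the last fact holds because some maximum matching uses the edge uv.
    For the inertia it holds because the 2 x 2 block carried by u and v can be
    split off by a congruence and has signature (1, 1). The structure
    [matching_like] collects these properties, for a function of the vertex set
    of an induced subgraph.

    Stripping leaves and isolated vertices until nothing is left computes such a
    function on a forest, so any two of them agree there
    ([matching_like_forest]). If removing a vertex set F leaves a forest, then
    two such functions differ by at most |F| on the whole graph. It remains to
    find a set F with |F| <= c(G) ([forest_complement]). Build up the vertex set
    of the connected graph G one vertex at a time, each new vertex having at
    least one earlier neighbour, and let F consist of the vertices with at least
    two. The numbers of earlier neighbours sum to |E|, so those of the
    non-initial vertices, each reduced by 1, sum to |E| - (|V| - 1) = c(G), and
    every member of F contributes at least 1 to that sum.

    The inertia is handled variationally: p(A) is the greatest k for which
    U A U^* is positive definite for some matrix U with k rows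
    ([pos_index_max], a consequence of the spectral theorem). In this form the
    vertex deletion bounds and the leaf reduction become constructions of such
    matrices U. Negative eigenvalues are the positive eigenvalues of -A, and -A
    has the same zero pattern as A. *)

Set Implicit Arguments.
Unset Strict Implicit.
Unset Printing Implicit Defensive.

Import Order.TTheory GRing.Theory Num.Theory.
Local Open Scope ring_scope.

(** * Feedback vertex sets and leaf stripping *)

Section Graph.
Local Open Scope nat_scope.
Variables (n : nat) (G : simple_graph n).
Implicit Types (S T F : {set 'I_n}) (u v w : 'I_n) (M : {set {set 'I_n}}).

Definition nbrs_in S v : {set 'I_n} := [set w in S | adj G v w].

(** What the matching number and both inertia indices of an induced subgraph
    have in common, as functions of its vertex set. *)
Record matching_like (mu : {set 'I_n} -> nat) : Prop := MatchingLike {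
  mu_set0 : mu set0 = 0;
  mu_del_le : forall S v, mu (S :\ v) <= mu S;
  mu_del_ge : forall S v, mu S <= (mu (S :\ v)).+1;
  mu_isolated : forall S v, nbrs_in S v = set0 -> mu (S :\ v) = mu S;
  mu_leaf : forall S u v, u \in S -> v \in S -> nbrs_in S u = [set v] ->
    mu (S :\: [set u; v]) < mu S
}.

(** A finite graph is acyclic exactly when each of its nonempty induced
    subgraphs has a vertex of degree at most 1. In this form the property is
    inherited by subsets, supplies the leaf needed to take a forest apart, and
    is easily kept when a vertex is attached by at most one edge. *)
Definition forest S : Prop :=
  forall T, T \subset S -> T != set0 ->
    exists2 v, v \in T & #|nbrs_in T v| <= 1.

Lemma forestS S T : T \subset S -> forest S -> forest T.
Proof. by move=> TS fS U UT; apply: fS; apply: subset_trans TS. Qed.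

(** Deleting the neighbour v of a leaf u costs at most 1 and leaves u isolated,
    so the leaf axiom gives mu S = mu (S - u - v) + 1. Stripping a forest in
    this way determines mu. *)
Lemma matching_like_forest mu1 mu2 S :
  matching_like mu1 -> matching_like mu2 -> forest S -> mu1 S = mu2 S.
Proof.
move=> m1 m2; have [k] := ubnP #|S|; elim: k S => // k IH S Sk fS.
have [->|SN0] := eqVneq S set0; first by rewrite !mu_set0.
have [u uS] := fS S (subxx S) SN0.
case: (posnP #|nbrs_in S u|) => [/cards0_eq N0 _|N_gt0 N_le1].
  rewrite -(mu_isolated m1 N0) -(mu_isolated m2 N0).
  apply: IH; last exact: forestS (subsetDl _ _) fS.
  by move: Sk; rewrite (cardsD1 u S) uS.
have /cards1P[v Nv] : #|nbrs_in S u| == 1 by rewrite eqn_leq N_le1.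
have [vS uv] : v \in S /\ adj G u v.
  by have := set11 v; rewrite -Nv inE => /andP.
have leaf mu : matching_like mu -> mu S = (mu (S :\: [set u; v])).+1.
  move=> m; apply/eqP; rewrite eqn_leq (mu_leaf m) // andbT.
  have -> : mu (S :\: [set u; v]) = mu (S :\ v).
    have -> : S :\: [set u; v] = S :\ v :\ u by rewrite setDDl setUC.
    apply: mu_isolated => //; apply/setP=> w; rewrite !inE.
    have := in_set0 w; have := in_set1 w v; rewrite -Nv !inE => <-.
    by case: (w \in S) => //=; case: (adj G u w).
  exact: mu_del_ge.
rewrite (leaf _ m1) (leaf _ m2); congr _.+1.
apply: IH; last exact: forestS (subsetDl _ _) fS.
apply: leq_trans (_ : #|S| <= k) => //; apply: proper_card.
by rewrite properE subsetDl; apply/subsetPn; exists u; rewrite // !inE eqxx.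
Qed.

Lemma matching_like_delete mu S F : matching_like mu ->
  mu (S :\: F) <= mu S <= mu (S :\: F) + #|F|.
Proof.
move=> m; have [k] := ubnP #|F|; elim: k F => // k IH F Fk.
have [->|[v vF]] := set_0Vmem F; first by rewrite setD0 cards0 addn0 leqnn.
have SE : S :\: F = S :\: (F :\ v) :\ v by rewrite setDDl setUC setD1K.
have := IH (F :\ v); rewrite (cardsD1 v F) vF in Fk * => /(_ Fk).
have := mu_del_le m (S :\: (F :\ v)) v; have := mu_del_ge m (S :\: (F :\ v)) v.
rewrite -SE; lia.
Qed.

Definition edges_in S : {set {set 'I_n}} := [set e in edges G | e \subset S].

Lemma edgesP e :
  reflect (exists i j, adj G i j /\ e = [set i; j]) (e \in edges G).
Proof.
apply: (iffP imset2P) => [[i j _ ]|[i [j [ij ->]]]].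
  by rewrite !inE => ij ->; exists i, j.
by exists i j; rewrite ?inE.
Qed.

(** The edges from v into S are in bijection with the neighbours of v in S, and
    none of them lies inside S. *)
Lemma edges_inU1 S v : v \notin S ->
  #|edges_in S| + #|nbrs_in S v| <= #|edges_in (v |: S)|.
Proof.
move=> vS; pose star := [set [set v; w] | w in nbrs_in S v].
have star_card : #|star| = #|nbrs_in S v|.
  apply: card_in_imset => w w' /=; rewrite !inE => /andP[wS _] /andP[w'S _] ww'.
  have : w \in [set v; w'] by rewrite -ww' !inE eqxx orbT.
  by rewrite !inE => /orP[/eqP wv|/eqP//]; rewrite -wv wS in vS.
have disj : [disjoint edges_in S & star].
  rewrite disjoint_sym disjoint_subset; apply/subsetP=> e /imsetP[w _ ->].
  rewrite !inE negb_and; apply/orP; right.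
  by apply: contra vS => /subsetP/(_ v); rewrite !inE eqxx; apply.
rewrite -star_card -cardsUI (disjoint_setI0 disj) cards0 addn0.
apply: subset_leq_card; apply/subsetP=> e; rewrite inE => /orP[].
  rewrite !inE => /andP[-> eS] /=; apply: subset_trans eS _; exact: subsetUr.
case/imsetP=> w; rewrite !inE => /andP[wS vw] ->; apply/andP; split.
  by apply/edgesP; exists v, w.
by rewrite subUset !sub1set !inE eqxx wS orbT.
Qed.

(** Otherwise S would be closed under adjacency, hence a union of connected
    components. *)
Lemma connected_boundary S : connected G -> S != set0 -> S != setT ->
  exists2 v, v \notin S & nbrs_in S v != set0.
Proof.
move=> Gconn /set0Pn[x xS] SNT.
have [/existsP[v /andP[vS vN]]|] :=
  boolP [exists v, (v \notin S) && (nbrs_in S v != set0)]; first by exists v.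
move=> /existsPn noV; case/eqP: SNT; apply/setP=> y; rewrite inE.
have cl : closed (adj G) (mem S).
  apply: intro_closed; first exact/sym_connect_sym/adj_sym.
  move=> i j ij iS; have := noV j; rewrite negb_and negbK => /orP[//|].
  rewrite negbK => /eqP/setP/(_ i); rewrite !inE (adj_sym G) ij andbT.
  by move: iS => /= ->.
by have /= <- := closed_connect cl (Gconn x y).
Qed.

(** A vertex subset containing v has v itself as a vertex of degree at most 1;
    any other subset already lies in S. *)
Lemma forestU1 S v : #|nbrs_in S v| <= 1 -> forest S -> forest (v |: S).
Proof.
move=> Nv fS T TS TN0; have [vT|vT] := boolP (v \in T).
  exists v => //; apply: leq_trans Nv; apply: subset_leq_card.
  apply/subsetP=> w; rewrite !inE => /andP[wT vw]; rewrite vw andbT.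
  have := subsetP TS w wT; rewrite !inE => /orP[/eqP wv|//].
  by rewrite wv (adj_irr G) in vw.
apply: fS TN0; apply/subsetP=> w wT; have := subsetP TS w wT; rewrite !inE.
by case/orP=> [/eqP wv|//]; rewrite -wv wT in vT.
Qed.

Lemma nbrs_inS S T v : S \subset T -> nbrs_in S v \subset nbrs_in T v.
Proof.
by move=> /subsetP ST; apply/subsetP=> w; rewrite !inE => /andP[/ST-> ->].
Qed.

(** S grows by one boundary vertex v at a time, and v is put into F when it has
    at least two neighbours in S. Then |F| + |S| rises by 1 while at least one
    edge is gained, or by 2 while at least two are. *)
Lemma forest_complement_grow : connected G -> forall k, 0 < k <= n ->
  exists S F, [/\ #|S| = k, F \subset S, forest (S :\: F) &
    #|F| + #|S| <= #|edges_in S| + 1].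
Proof.
move=> Gconn; elim=> // -[|k] IH kn.
  exists [set Ordinal kn], set0; rewrite cards1 cards0 sub0set; split=> //.
  - rewrite setD0 => T TS TN0; have [v vT] := set0Pn _ TN0.
    exists v => //; apply: leq_trans (subset_leq_card (_ : _ \subset T)) _.
      by apply/subsetP=> w; rewrite inE => /andP[].
    by apply: leq_trans (subset_leq_card TS) _; rewrite cards1.
  - by rewrite leq_add2r.
have [S [F [Sk FS fSF cF]]] := IH (ltnW kn).
have [||v vS] := connected_boundary (S := S) Gconn.
- by rewrite -card_gt0 Sk.
- apply: contraTneq kn => ST; rewrite -Sk ST cardsT card_ord ltnn //.
rewrite -card_gt0 => N_gt0.
have vF : v \notin F by apply: contra vS; apply: (subsetP FS).
have card_vS : #|v |: S| = k.+2 by rewrite cardsU1 vS Sk.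
have := edges_inU1 vS.
have [N1|N2] := leqP #|nbrs_in S v| 1 => edgeU.
  exists (v |: S), F; split=> //.
  - exact: subset_trans FS (subsetUr _ _).
  - have -> : (v |: S) :\: F = v |: (S :\: F).
      apply/setP=> w; rewrite !inE; case: eqP => [->|//]; by rewrite vF.
    apply: forestU1 fSF; apply: leq_trans N1.
    exact/subset_leq_card/nbrs_inS/subsetDl.
  - rewrite card_vS addnS addn1 ltnS; apply: leq_trans edgeU.
    by rewrite -Sk (leq_trans cF) // leq_add2l.
exists (v |: S), (v |: F); split=> //.
- exact: setUS.
- have -> : (v |: S) :\: (v |: F) = S :\: F.
    apply/setP=> w; rewrite !inE negb_or; case: eqP => [->|//] /=.
    by rewrite (negPf vS) andbF.
  exact: fSF.
- rewrite card_vS cardsU1 vF add1n addSn addnS addn1 ltnS.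
  by apply: leq_trans edgeU; rewrite -Sk (leq_ltn_trans cF) // ltn_add2l.
Qed.

Lemma edges_inT : edges_in setT = edges G.
Proof. by apply/setP=> e; rewrite inE subsetT andbT. Qed.

Lemma num_components_connected : connected G -> 0 < n -> num_components G = 1.
Proof.
move=> Gconn n_gt0.
rewrite -(n_comp_connect (sym_connect_sym (adj_sym G)) (Ordinal n_gt0)).
apply: eq_n_comp_r => j; rewrite !inE; symmetry; exact: Gconn.
Qed.

(** With all n vertices in S, the bound kept while growing S reads
    |F| <= |E| - n + 1, which is c(G) because there is one component. *)
Lemma forest_complement : connected G ->
  exists2 F, forest (~: F) & (#|F|%:Z <= cyclomatic G)%R.
Proof.
move=> Gconn; case: (posnP n) => [n0|n_gt0].
  (* Without vertices there is nothing to grow from, and c(G) = 0. *)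
  exists set0; last by rewrite /cyclomatic cards0; lia.
  by move=> T _ /set0Pn[v]; have := ltn_ord v; lia.
have [|S [F [Sn _]]] := forest_complement_grow Gconn (k := n).
  by rewrite n_gt0 leqnn.
have -> : S = setT.
  by apply/eqP; rewrite eqEcard subsetT cardsT card_ord Sn leqnn.
rewrite setTD edges_inT cardsT card_ord => fF cF; exists F => //.
rewrite /cyclomatic num_components_connected //; lia.
Qed.

(** The two functions agree on the forest left after deleting F, and the
    deletion lowers each of them by an amount between 0 and |F|, so they differ
    by at most |F| and not merely 2 |F|. *)
Lemma matching_like_diff mu1 mu2 :
  connected G -> matching_like mu1 -> matching_like mu2 ->
  ((mu1 setT)%:Z <= (mu2 setT)%:Z + cyclomatic G)%R.
Proof.
move=> Gconn m1 m2; have [F fF cF] := forest_complement Gconn.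
have := matching_like_forest m1 m2 fF.
have := matching_like_delete setT F m1; have := matching_like_delete setT F m2.
rewrite setTD; lia.
Qed.

(** * The matching number under vertex deletion *)

Definition matching_number_in S : nat :=
  \max_(M | is_matching G M && (cover M \subset S)) #|M|.

Lemma matching_number_inT : matching_number_in setT = matching_number G.
Proof. by apply: eq_bigl => M; rewrite subsetT andbT. Qed.

Lemma matching_number_in_max S :
  exists2 M, is_matching G M && (cover M \subset S) &
    #|M| = matching_number_in S.
Proof.
pose P := [pred M | is_matching G M && (cover M \subset S)].
have P0 : P set0.
  rewrite /= /is_matching sub0set /cover big_set0 sub0set andbT.
  by apply/trivIsetP=> A B; rewrite inE.
have [|M PM ME] := @eq_bigmax_cond _ P (fun M => #|M|).
  by apply/card_gt0P; exists set0.
by exists M; rewrite // -ME; apply: eq_bigl.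
Qed.

Lemma is_matchingS M M' : M' \subset M -> is_matching G M -> is_matching G M'.
Proof.
move=> M'M /andP[ME Mtriv]; rewrite /is_matching (subset_trans M'M ME) /=.
exact: trivIsetS Mtriv.
Qed.

Lemma matching_number_in_ge S M :
  is_matching G M -> cover M \subset S -> #|M| <= matching_number_in S.
Proof.
by move=> Mm MS; apply: (leq_bigmax_cond (F := fun M => #|M|)); rewrite Mm.
Qed.

Lemma matching_like_matching_number : matching_like matching_number_in.
Proof.
split.
- have [M /andP[/andP[ME _] M0] <-] := matching_number_in_max set0.
  apply: eq_card0 => e; apply/negbTE/negP=> eM.
  have /edgesP[i [j [_ eE]]] := subsetP ME e eM.
  suff /(subsetP M0) : i \in cover M by rewrite inE.
  by apply/bigcupP; exists e => //; rewrite eE !inE eqxx.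
- move=> S v; have [M /andP[Mm MS] <-] := matching_number_in_max (S :\ v).
  by apply: matching_number_in_ge => //; apply: subset_trans MS (subsetDl _ _).
(* At most one edge of a matching contains v: the block of v. *)
- move=> S v; have [M /andP[Mm MS] <-] := matching_number_in_max S.
  have /andP[_ Mtriv] := Mm.
  pose B := pblock M v.
  have le : #|M| <= #|M :\ B|.+1 by rewrite (cardsD1 B M); case: (_ \in _).
  apply: (leq_trans le); rewrite ltnS; apply: matching_number_in_ge.
    exact: is_matchingS (subsetDl _ _) Mm.
  apply/bigcupsP=> e; rewrite !inE => /andP[eB eM].
  rewrite subsetD1 (subset_trans (bigcup_sup e eM) MS) /=.
  by apply: contra eB => ve; rewrite eq_sym; apply/eqP/def_pblock.
- move=> S v Nv0; apply/eqP; rewrite eqn_leq; apply/andP; split.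
    have [M /andP[Mm MS] <-] := matching_number_in_max (S :\ v).
    apply: matching_number_in_ge => //.
    exact: subset_trans MS (subsetDl _ _).
  have [M /andP[Mm MS] <-] := matching_number_in_max S.
  apply: matching_number_in_ge => //; rewrite subsetD1 MS /=.
  apply/bigcupP=> -[e eM ve]; have eS := subset_trans (bigcup_sup e eM) MS.
  have /andP[ME _] := Mm.
  have /edgesP[i [j [ij eE]]] := subsetP ME e eM.
  have noN w : w \in e -> adj G v w -> False.
    by move=> we vw; have := in_set0 w; rewrite -Nv0 inE vw (subsetP eS).
  move: ve; rewrite eE !inE => /orP[]/eqP vE; rewrite vE in noN.
    by apply: (noN j) => //; rewrite eE !inE eqxx orbT.
  by apply: (noN i); [rewrite eE !inE eqxx | rewrite (adj_sym G)].
(* A matching that avoids u and v can be enlarged by the edge uv. *)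
- move=> S u v uS vS Nu.
  have [M /andP[Mm MS] <-] := matching_number_in_max (S :\: [set u; v]).
  have uv : adj G u v by have := set11 v; rewrite -Nu inE => /andP[].
  have /andP[ME Mtriv] := Mm.
  have eM e : e \in M -> [disjoint [set u; v] & e].
    move=> eM; rewrite disjoint_sym.
    have := subset_trans (bigcup_sup e eM) MS.
    by rewrite subsetD => /andP[].
  have newM : [set u; v] \notin M.
    by apply/negP=> /eM/disjointFr/(_ (set21 u v)); rewrite set21.
  have -> : #|M|.+1 = #|[set u; v] |: M| by rewrite cardsU1 newM.
  apply: matching_number_in_ge.
    rewrite /is_matching subUset sub1set ME andbT; apply/andP; split.
      by apply/edgesP; exists u, v.
    apply/trivIsetP=> A B; rewrite !inE.
    case/orP=> [/eqP->|AM]; case/orP=> [/eqP->|BM] //; first by rewrite eqxx.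
    + by move=> _; apply: eM.
    + by move=> _; rewrite disjoint_sym; apply: eM.
    + by move=> AB; have /trivIsetP := Mtriv; apply.
  apply/bigcupsP=> e; rewrite !inE => /orP[/eqP->|eM'].
    by rewrite subUset !sub1set uS vS.
  apply: subset_trans (bigcup_sup e eM') _.
  exact: subset_trans MS (subsetDl _ _).
Qed.

End Graph.

(** * Dimension of positive subspaces of a Hermitian form *)

Section PositiveIndex.
Local Open Scope sesquilinear_scope.
Variable C : numClosedFieldType.

Definition posdef k (M : 'M[C]_k) : Prop :=
  forall x : 'rV_k, x != 0 -> 0 < (x *m M *m x^t*) 0 0.

(** The rows of U span a subspace on which the form x A x^* is positive
    definite. Its dimension is k, because a positive definite U A U^* forces the
    rows of U to be independent. *)
Definition pos_dim n (A : 'M[C]_n) (k : nat) : Prop :=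
  exists U : 'M[C]_(k, n), posdef (U *m A *m U^t*).

(** For an adjacency matrix A, this is the adjacency matrix of the subgraph
    induced by S padded with zero rows and columns. Keeping the size n avoids
    changes of index type, and the padding does not affect the number of positive
    eigenvalues. *)
Definition mask_mx n (S : {set 'I_n}) (A : 'M[C]_n) : 'M[C]_n :=
  \matrix_(i, j) if (i \in S) && (j \in S) then A i j else 0.

Definition proj_on n (S : {set 'I_n}) : 'M[C]_n :=
  diag_mx (\row_i (i \in S)%:R).

Lemma ctrmx_mul m n p (A : 'M[C]_(m, n)) (B : 'M[C]_(n, p)) :
  (A *m B)^t* = B^t* *m A^t*.
Proof. by rewrite trmx_mul map_mxM. Qed.

Lemma ctrmx0 m n : (0 : 'M[C]_(m, n))^t* = 0.
Proof. by rewrite trmx0 map_mx0. Qed.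

Lemma ctrmxD m n (A B : 'M[C]_(m, n)) : (A + B)^t* = A^t* + B^t*.
Proof. by rewrite linearD map_mxD. Qed.

Lemma ctrmxZ m n a (A : 'M[C]_(m, n)) : (a *: A)^t* = a^* *: A^t*.
Proof. by rewrite linearZ map_mxZ. Qed.

Lemma proj_on_ctr n (S : {set 'I_n}) : (proj_on S)^t* = proj_on S.
Proof.
apply/matrixP=> i j; rewrite !mxE rmorphMn /= conjC_nat eq_sym.
by case: eqP => [->|]; rewrite ?mulr1n ?mulr0n.
Qed.

Lemma mulmx_proj_on m n (S : {set 'I_n}) (U : 'M[C]_(m, n)) i j :
  (U *m proj_on S) i j = if j \in S then U i j else 0.
Proof.
by rewrite mul_mx_diag !mxE; case: ifP => _; rewrite ?mulr1 ?mulr0.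
Qed.

Lemma mask_mxE n (S : {set 'I_n}) (A : 'M[C]_n) :
  mask_mx S A = proj_on S *m A *m (proj_on S)^t*.
Proof.
rewrite proj_on_ctr; apply/matrixP=> i j.
rewrite mulmx_proj_on mul_diag_mx !mxE.
by case: (i \in S); case: (j \in S); rewrite /= ?mul1r ?mul0r.
Qed.

Lemma mask_mx_herm n (S : {set 'I_n}) (A : 'M[C]_n) :
  A^t* = A -> (mask_mx S A)^t* = mask_mx S A.
Proof. by move=> hA; rewrite mask_mxE !ctrmx_mul hA trmxCK mulmxA. Qed.

Lemma mask_mx_mask n (S T : {set 'I_n}) (A : 'M[C]_n) :
  mask_mx S (mask_mx T A) = mask_mx (S :&: T) A.
Proof.
apply/matrixP=> i j; rewrite !mxE !inE.
by case: (i \in S); case: (j \in S); case: (i \in T); case: (j \in T).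
Qed.

Lemma mask_mx_setT n (A : 'M[C]_n) : mask_mx setT A = A.
Proof. by apply/matrixP=> i j; rewrite !mxE !inE. Qed.

Lemma posdef_rowfree r k (K : 'M[C]_(r, k)) (M : 'M[C]_k) :
  row_free K -> posdef M -> posdef (K *m M *m K^t*).
Proof.
move=> Kfree Mpos x xN0; have := Mpos (x *m K).
by rewrite mulmx_free_eq0 // ctrmx_mul !mulmxA; apply.
Qed.

(** Vanishing on T imposes |T| linear conditions, so K is a basis of the left
    kernel of the columns of U indexed by T. *)
Lemma combinations_vanishing_on k n (U : 'M[C]_(k, n)) (T : {set 'I_n}) :
  exists r (K : 'M[C]_(r, k)),
    [/\ (k <= r + #|T|)%N, row_free K &
        forall i j, j \in T -> (K *m U) i j = 0].
Proof.
pose UT := colsub (@enum_val _ (mem T)) U.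
exists (\rank (kermx UT)), (row_base (kermx UT)); split.
- by rewrite mxrank_ker -leq_subLR subKn ?rank_leq_col // rank_leq_row.
- exact: row_base_free.
move=> i j jT; have : row_base (kermx UT) *m UT == 0.
  by apply/eqP/sub_kermxP; rewrite eq_row_base.
move=> /eqP/matrixP/(_ i (enum_rank_in jT j)).
by rewrite mulmx_colsub !mxE enum_rankK_in // => <-.
Qed.

(** Covers both masking, where Q is a coordinate projection, and a change of
    basis. *)
Lemma pos_dim_congr m n (Q : 'M[C]_(m, n)) (A : 'M[C]_n) k :
  pos_dim (Q *m A *m Q^t*) k -> pos_dim A k.
Proof.
case=> U Upos; exists (U *m Q).
by rewrite ctrmx_mul !mulmxA in Upos *.
Qed.

(** On the vectors vanishing on T, a subspace of codimension at most |T|, the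
    form of A and the form of its masked version coincide. *)
Lemma pos_dim_mask n (T : {set 'I_n}) (A : 'M[C]_n) k :
  pos_dim A k -> exists2 r, pos_dim (mask_mx (~: T) A) r & (k <= r + #|T|)%N.
Proof.
case=> U Upos; have [r [K [kr Kfree KU0]]] := combinations_vanishing_on U T.
exists r => //; exists (K *m U).
have -> : K *m U *m mask_mx (~: T) A *m (K *m U)^t* =
    K *m (U *m A *m U^t*) *m K^t*.
  have KUE : K *m U *m proj_on (~: T) = K *m U.
    apply/matrixP=> i j; rewrite mulmx_proj_on inE.
    by case: ifPn => // /negPn/KU0->.
  rewrite mask_mxE !mulmxA KUE -[LHS]mulmxA -ctrmx_mul KUE.
  by rewrite ctrmx_mul !mulmxA.
exact: posdef_rowfree.
Qed.

Lemma pos_dim0 n k : pos_dim (0 : 'M[C]_n) k -> k = 0%N.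
Proof.
case: k => // k [U]; rewrite mulmx0 mul0mx => /(_ (delta_mx 0 0)).
rewrite mulmx0 mul0mx mxE ltxx => F; suff : false by []. apply: F.
by apply/eqP=> /matrixP/(_ 0 0)/eqP; rewrite !mxE !eqxx oner_eq0.
Qed.

(** Two subspaces orthogonal for the form B, on each of which it is positive
    definite, span a subspace on which it is positive definite. *)
Lemma posdef_col_mx r k n (B : 'M[C]_n) (W : 'M[C]_(r, n)) (Y : 'M[C]_(k, n)) :
  posdef (W *m B *m W^t*) -> posdef (Y *m B *m Y^t*) ->
  W *m B *m Y^t* = 0 -> Y *m B *m W^t* = 0 ->
  posdef (col_mx W Y *m B *m (col_mx W Y)^t*).
Proof.
move=> Wpos Ypos WBY YBW x.
rewrite -[x]hsubmxK; set x1 := lsubmx x; set x2 := rsubmx x => xN0.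
have -> : row_mx x1 x2 *m (col_mx W Y *m B *m (col_mx W Y)^t*)
    *m (row_mx x1 x2)^t* = x1 *m (W *m B *m W^t*) *m x1^t* +
      x2 *m (Y *m B *m Y^t*) *m x2^t*.
  transitivity ((x1 *m W + x2 *m Y) *m B *m (x1 *m W + x2 *m Y)^t*).
    by rewrite -mul_row_col ctrmx_mul !mulmxA.
  rewrite ctrmxD !ctrmx_mul mulmxDr !mulmxDl !mulmxA.
  have -> : x2 *m Y *m B *m W^t* = 0 by rewrite -2!mulmxA (mulmxA Y) YBW mulmx0.
  have -> : x1 *m W *m B *m Y^t* = 0 by rewrite -2!mulmxA (mulmxA W) WBY mulmx0.
  by rewrite !mul0mx addr0 add0r.
have form_ge0 m (M : 'M[C]_m) (y : 'rV_m) :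
    posdef M -> 0 <= (y *m M *m y^t*) 0 0.
  by have [->|/[swap]/[apply]/ltW//] := eqVneq y 0; rewrite !mul0mx mxE.
rewrite mxE; have [x20|x2N0] := eqVneq x2 0.
  rewrite ltr_wpDr ?form_ge0 // Wpos //; apply: contraNneq xN0 => x10.
  by rewrite x10 x20 row_mx0.
by rewrite ltr_wpDl ?form_ge0 // Ypos.
Qed.

Lemma ctr_delta n (u : 'I_n) :
  (delta_mx 0 u : 'rV[C]_n)^t* = delta_mx u 0.
Proof. by rewrite trmx_delta map_delta_mx. Qed.

(** Let X be a positive subspace avoiding the coordinates u and v. Since row u
    of B is a multiple of e_v, adding multiples of e_u to the vectors of X does
    not change the form on them, and it can be used to make them B-orthogonal to
    e_v. The vector w = e_v + a^-1 e_u, of square 2, is then orthogonal to all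
    of them and adds one dimension. *)
Lemma pos_dim_leaf n (B : 'M[C]_n) (u v : 'I_n) k :
  B^t* = B -> u != v -> B u v != 0 -> B v v = 0 ->
  (forall w, w != v -> B u w = 0) ->
  pos_dim (mask_mx (~: [set u; v]) B) k -> pos_dim B k.+1.
Proof.
move=> Bherm uv a0 Bvv Bu [U Upos].
set a := B u v in a0.
pose eu : 'rV[C]_n := delta_mx 0 u; pose ev : 'rV[C]_n := delta_mx 0 v.
have euB : eu *m B = a *: ev.
  apply/rowP=> j; rewrite -rowE !mxE /=.
  by have [->|/Bu->] := eqVneq j v; rewrite ?mulr1 ?mulr0.
have Beu : B *m eu^t* = a^* *: ev^t*.
  by rewrite -ctrmxZ -euB ctrmx_mul Bherm.
pose X := U *m proj_on (~: [set u; v]).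
have Xv : X *m ev^t* = 0.
  by rewrite ctr_delta -colE; apply/matrixP=> i j;
     rewrite mxE mulmx_proj_on !inE eqxx orbT mxE.
(* The coefficients of e_u that make Y orthogonal to e_v. *)
pose t : 'cV[C]_k := - (a^-1 *: (X *m B *m ev^t*)).
pose Y := X + t *m eu.
have euev : eu *m ev^t* = 0.
  by rewrite ctr_delta mul_delta_mx_0.
have Yv : Y *m ev^t* = 0 by rewrite mulmxDl Xv -mulmxA euev mulmx0 addr0.
have YBeu : Y *m B *m eu^t* = 0 by rewrite -mulmxA Beu -scalemxAr Yv scaler0.
have evev : ev *m ev^t* = 1%:M.
  by rewrite ctr_delta mul_delta_mx; apply/matrixP=> i j; rewrite !ord1 !mxE.
have YBev : Y *m B *m ev^t* = 0.
  rewrite !mulmxDl -(mulmxA t) euB -(mulmxA t) -scalemxAl evev.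
  by rewrite -scalemxAr mulmx1 scalerN scalerA mulfV // scale1r subrr.
pose w := ev + a^-1 *: eu.
have YBw : Y *m B *m w^t* = 0.
  by rewrite ctrmxD ctrmxZ mulmxDr -scalemxAr YBeu YBev scaler0 addr0.
have wBY : w *m B *m Y^t* = 0.
  by rewrite -(ctrmx0 k 1) -YBw !ctrmx_mul trmxCK Bherm mulmxA.
have wBw : w *m B *m w^t* = 2%:M.
  have wB : w *m B = ev *m B + ev.
    by rewrite mulmxDl -scalemxAl euB scalerA mulVf // scale1r.
  have evBev : ev *m B *m ev^t* = 0.
    rewrite ctr_delta -colE -rowE; apply/matrixP=> i j.
    by rewrite !mxE.
  have evBeu : ev *m B *m eu^t* = a^*%:M.
    by rewrite -mulmxA Beu -scalemxAr evev scalemx1.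
  have eveu : ev *m eu^t* = 0 by rewrite ctr_delta mul_delta_mx_0 // eq_sym.
  rewrite wB ctrmxD ctrmxZ mulmxDr -scalemxAr !mulmxDl evBev evev evBeu eveu.
  have conj_aV : (a^-1)^* * a^* = 1 by rewrite fmorphV mulVf // conjC_eq0.
  rewrite add0r addr0 scale_scalar_mx conj_aV.
  by apply/matrixP=> i j; rewrite !mxE -mulrnDl.
have YBY : Y *m B *m Y^t* = U *m mask_mx (~: [set u; v]) B *m U^t*.
  rewrite {2}/Y ctrmxD (ctrmx_mul t) mulmxDr [Y *m B *m (_ *m _)]mulmxA YBeu.
  rewrite mul0mx addr0.
  rewrite !mulmxDl -(mulmxA t) euB -scalemxAr -scalemxAl.
  have -> : t *m ev *m X^t* = 0.
    by rewrite -mulmxA -[ev]trmxCK -ctrmx_mul Xv ctrmx0 mulmx0.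
  by rewrite scaler0 addr0 mask_mxE ctrmx_mul !mulmxA.
exists (col_mx w Y : 'M_(1 + k, n)); apply: (@posdef_col_mx 1 k) => //.
  rewrite wBw => x xN0; rewrite mul_mx_scalar -scalemxAl !mxE big_ord1 !mxE.
  rewrite mulr_gt0 // mul_conjC_gt0; apply: contraNneq xN0 => x0.
  by apply/eqP/matrixP=> i j; rewrite !ord1 x0 mxE.
by rewrite YBY.
Qed.

Lemma pos_dim_diag n (d : 'rV[C]_n) :
  pos_dim (diag_mx d) #|[set i | 0 < d 0 i]|.
Proof.
set T := [set i | _]; pose f : 'I_#|T| -> 'I_n := @enum_val _ (mem T).
exists (rowsub f 1%:M) => x xN0.
have -> : rowsub f 1%:M *m diag_mx d *m (rowsub f 1%:M)^t* =
    diag_mx (\row_i d 0 (f i)).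
  rewrite trmx_mxsub map_mxsub trmx1 map_mx1 mul_rowsub_mx mul1mx.
  rewrite mulmx_colsub mulmx1; apply/matrixP=> i j.
  by rewrite !mxE (inj_eq enum_val_inj).
have d_gt0 i : 0 < d 0 (f i) by have := enum_valP i; rewrite inE.
have term i : x 0 i * d 0 (f i) * (x 0 i)^* = d 0 (f i) * `|x 0 i| ^+ 2.
  by rewrite mulrAC mulrC normCK.
rewrite mul_mx_diag mxE.
have /existsP[i xi] : [exists i, x 0 i != 0].
  apply: contraNT xN0 => /existsPn x0; apply/eqP/rowP=> i.
  by rewrite mxE; have /negPn/eqP := x0 i.
rewrite (bigD1 i) //= ltr_wpDr //; last first.
  by rewrite !mxE term mulr_gt0 // exprn_gt0 // normr_gt0.
apply: sumr_ge0 => j _; rewrite !mxE term.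
by rewrite mulr_ge0 ?exprn_ge0 // ltW.
Qed.

(** A larger positive subspace would contain a nonzero vector whose coordinates
    vanish wherever d is positive, and there the form is at most 0. *)
Lemma pos_dim_diag_le n (d : 'rV[C]_n) k :
  (forall i, d 0 i \is Num.real) ->
  pos_dim (diag_mx d) k -> (k <= #|[set i | (0 < d 0 i)%R]|)%N.
Proof.
move=> d_real [U Upos]; set T := [set i | _]; rewrite leqNgt; apply/negP=> kT.
have [r [K [kr Kfree KU0]]] := combinations_vanishing_on U T.
have := posdef_rowfree Kfree Upos.
case: r => [|r] in K kr Kfree KU0 *; first by rewrite leqNgt kT in kr.
move=> /(_ (delta_mx 0 0)); set y := K *m U in KU0.
rewrite (_ : _ *m _ = row 0 y *m diag_mx d *m (row 0 y)^t*); last first.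
  by rewrite rowE /y !ctrmx_mul !mulmxA.
clearbody y; rewrite mul_mx_diag mxE => F.
have {F} : 0 < \sum_j
    (\matrix_(i, j) (row 0 y i j * d 0 j)) 0 j * (row 0 y)^t* j 0.
  apply: F; apply/eqP=> /matrixP/(_ 0 0)/eqP.
  by rewrite !mxE !eqxx oner_eq0.
move=> /lt_geF/negbT/negP; apply; apply: sumr_le0 => j _; rewrite !mxE.
have [jT|jT] := boolP (j \in T); first by rewrite KU0 // !mul0r.
rewrite mulrAC mulrC mulr_le0_ge0 ?mul_conjC_ge0 //.
by rewrite inE -real_leNgt ?real0 in jT.
Qed.

End PositiveIndex.

(** * Counting eigenvalues *)

Lemma char_poly_conj (K : comUnitRingType) n (P D : 'M[K]_n) :
  P \in unitmx -> char_poly (invmx P *m D *m P) = char_poly D.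
Proof.
move=> Pu; pose Pp := map_mx polyC P; pose Qp := map_mx polyC (invmx P).
have QP : Qp *m Pp = 1%:M by rewrite -map_mxM mulVmx // map_mx1.
have -> : char_poly (invmx P *m D *m P) = \det (Qp *m char_poly_mx D *m Pp).
  congr (\det _); rewrite /char_poly_mx mulmxBr mulmxBl !map_mxM.
  by rewrite scalar_mxC -(mulmxA _ Qp) QP mulmx1.
by rewrite !det_mulmx mulrAC -det_mulmx QP det1 mul1r.
Qed.

Section Eigenvalues.
Local Open Scope sesquilinear_scope.
Variable R : realType.
Local Notation C := R[i].

Lemma eigenvalues_conj_diag n (A P : 'M[C]_n) (d : 'rV[C]_n) :
  P \in unitmx -> A = invmx P *m diag_mx d *m P ->
  perm_eq (eigenvalues A) [seq d 0 i | i <- enum 'I_n].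
Proof.
move=> Pu ->; rewrite /eigenvalues; case: closed_field_poly_normal => s /= sE.
have := sE; rewrite (monicP (char_poly_monic _)) scale1r char_poly_conj //.
rewrite char_poly_trig ?diag_mx_is_trig // => prodE.
apply: prod_XsubC_eq; rewrite -prodE big_map big_enum /=.
by apply: eq_bigr => i _; rewrite mxE eqxx.
Qed.

Lemma hermitian_diagonalization n (A : 'M[C]_n) : A^t* = A ->
  spectralmx A \in unitmx /\
  A = invmx (spectralmx A) *m diag_mx (spectral_diag A) *m spectralmx A.
Proof.
move=> Aherm; split; first exact: spectral_unit.
by apply/orthomx_spectralP/hermitian_normalmx/is_hermitianmxP;
   rewrite expr0 scale1r Aherm.
Qed.

Definition pos_index n (A : 'M[C]_n) : nat :=
  count (fun x => 0 < x) (eigenvalues A).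

Lemma eigenvaluesN n (A : 'M[C]_n) : A^t* = A ->
  perm_eq (eigenvalues (- A)) [seq - x | x <- eigenvalues A].
Proof.
move=> Aherm; have [Pu AE] := hermitian_diagonalization Aherm.
apply: perm_trans (eigenvalues_conj_diag (d := - spectral_diag A) Pu _) _.
  by rewrite {1}AE raddfN mulmxN mulNmx.
rewrite perm_sym.
apply: perm_trans (perm_map _ (eigenvalues_conj_diag Pu AE)) _.
rewrite -map_comp; apply/permP=> p; rewrite !count_map.
by apply: eq_count => i /=; rewrite mxE.
Qed.

(** Variational description of the number of positive eigenvalues: the greatest
    dimension of a positive subspace. This follows from diagonalization by a
    unitary congruence, which preserves the dimensions of positive subspaces. *)
Lemma pos_index_max n (A : 'M[C]_n) : A^t* = A ->
  pos_dim A (pos_index A) /\ forall k, pos_dim A k -> (k <= pos_index A)%N.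
Proof.
move=> Aherm; have [Pu AE] := hermitian_diagonalization Aherm.
set P := spectralmx A in Pu AE; set d := spectral_diag A in AE.
have Punitary : P \is unitarymx by exact: spectral_unitarymx.
have PV : invmx P = P^t* by exact: invmx_unitary.
have -> : pos_index A = #|[set i | 0 < d 0 i]|.
  rewrite /pos_index (permP (eigenvalues_conj_diag Pu AE)) count_map.
  by rewrite -sum1_count big_enum_cond sum1dep_card.
have DE : diag_mx d = P *m A *m P^t*.
  by rewrite AE !mulmxA mulmxV // mul1mx -PV mulmxK.
split.
  by apply: (pos_dim_congr (Q := P)); rewrite -DE; apply: pos_dim_diag.
move=> k Ak; apply: pos_dim_diag_le.
  move=> i; apply/mxOverP; apply: hermitian_spectral_diag_real.
  by apply/is_hermitianmxP; rewrite expr0 scale1r Aherm.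
by apply: (pos_dim_congr (Q := P^t*)); rewrite trmxCK -PV -AE.
Qed.

End Eigenvalues.

(** * The positive index under vertex deletion *)

Section PositiveIndexGraph.
Local Open Scope sesquilinear_scope.
Variables (R : realType) (n : nat) (G : simple_graph n) (A : 'M[R[i]]_n).
Hypothesis Aherm : A^t* = A.
Hypothesis Asupp : forall i j, (A i j != 0) = adj G i j.

Lemma pos_index_mask_del_le (S : {set 'I_n}) v :
  (pos_index (mask_mx (S :\ v) A) <= pos_index (mask_mx S A))%N.
Proof.
have [_ maxS] := pos_index_max (mask_mx_herm S Aherm).
have [dimSv _] := pos_index_max (mask_mx_herm (S :\ v) Aherm).
apply: maxS; move: (pos_index (mask_mx (S :\ v) A)) dimSv => k.
rewrite setDE setIC -mask_mx_mask mask_mxE; exact: pos_dim_congr.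
Qed.

Lemma pos_index_mask_del_ge (S : {set 'I_n}) v :
  (pos_index (mask_mx S A) <= (pos_index (mask_mx (S :\ v) A)).+1)%N.
Proof.
have [dimS _] := pos_index_max (mask_mx_herm S Aherm).
have [_ maxSv] := pos_index_max (mask_mx_herm (S :\ v) Aherm).
have [r dim_r] := pos_dim_mask [set v] dimS.
rewrite cards1 addn1 => /leq_trans; apply; rewrite ltnS; apply: maxSv.
by rewrite setDE setIC -mask_mx_mask.
Qed.

(** Row and column v are already zero in the matrix masked by S. *)
Lemma mask_mx_isolated (S : {set 'I_n}) v :
  nbrs_in G S v = set0 -> mask_mx (S :\ v) A = mask_mx S A.
Proof.
move=> Nv0; have Av w : w \in S -> A v w = 0.
  move=> wS; apply/eqP; apply: contraFT (in_set0 w); rewrite Asupp -Nv0 => vw.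
  by rewrite inE wS.
have Av' w : w \in S -> A w v = 0.
  move=> wS; apply/eqP; rewrite -[_ == _]negbK Asupp (adj_sym G) -Asupp negbK.
  exact/eqP/Av.
apply/matrixP=> i j; rewrite !mxE !inE.
have [->|_] := eqVneq i v; have [->|_] := eqVneq j v; rewrite ?andbF //=.
- by case: ifP => // /andP[vS _]; rewrite Av.
- by case: ifP => // /andP[_ jS]; rewrite Av.
- by case: ifP => // /andP[iS _]; rewrite Av'.
Qed.

Lemma pos_index_mask_leaf (S : {set 'I_n}) u v :
  u \in S -> v \in S -> nbrs_in G S u = [set v] ->
  (pos_index (mask_mx (S :\: [set u; v]) A) < pos_index (mask_mx S A))%N.
Proof.
move=> uS vS Nu; have [_ maxS] := pos_index_max (mask_mx_herm S Aherm).
have [dimD _] := pos_index_max (mask_mx_herm (S :\: [set u; v]) Aherm).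
have uv : adj G u v by have := set11 v; rewrite -Nu inE => /andP[].
apply: maxS; apply: (@pos_dim_leaf _ _ _ u v).
- exact: mask_mx_herm.
- by apply: contraTneq uv => ->; rewrite (adj_irr G).
- by rewrite mxE uS vS Asupp.
- by rewrite mxE vS; apply/eqP; rewrite -[_ == _]negbK Asupp (adj_irr G).
- move=> w wv; rewrite mxE uS /=; case: ifP => // wS; apply/eqP.
  by apply: contraNT wv; rewrite Asupp => uw; rewrite -in_set1 -Nu inE wS.
- by rewrite mask_mx_mask setIC -setDE.
Qed.

Lemma matching_like_pos_index :
  matching_like G (fun S => pos_index (mask_mx S A)).
Proof.
split.
- have [+ _] := pos_index_max (mask_mx_herm set0 Aherm).
  suff {1}-> : mask_mx set0 A = 0 by apply: pos_dim0.
  by apply/matrixP=> i j; rewrite !mxE inE.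
- exact: pos_index_mask_del_le.
- exact: pos_index_mask_del_ge.
- by move=> S v /mask_mx_isolated->.
- exact: pos_index_mask_leaf.
Qed.

End PositiveIndexGraph.

(** * Gain graphs *)

Section GainGraph.
Local Open Scope sesquilinear_scope.
Variables (R : realType) (n : nat) (G : gain_graph R n).

Lemma adjmx_herm : (adjmx G)^t* = adjmx G.
Proof.
apply/matrixP=> i j; rewrite !mxE (adj_sym (ugraph G)).
case: ifP => [ij|_]; last exact: conjC0.
by rewrite (gain_inv ij) invC_norm gain_unit 1?(adj_sym (ugraph G)) //
  expr1n invr1 mul1r.
Qed.

Lemma adjmx_supp i j : (adjmx G i j != 0) = adj (ugraph G) i j.
Proof.
rewrite mxE; case: ifP => [ij|_]; last by rewrite eqxx.
by rewrite -normr_gt0 gain_unit ?ltr01.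
Qed.

Lemma neg_inertiaE : neg_inertia G = pos_index (- adjmx G).
Proof.
rewrite /pos_index (permP (eigenvaluesN adjmx_herm)) count_map.
by apply: eq_count => x /=; rewrite oppr_gt0.
Qed.

Lemma matching_like_pos_inertia :
  matching_like (ugraph G) (fun S => pos_index (mask_mx S (adjmx G))).
Proof. exact: matching_like_pos_index adjmx_herm adjmx_supp. Qed.

Lemma matching_like_neg_inertia :
  matching_like (ugraph G) (fun S => pos_index (mask_mx S (- adjmx G))).
Proof.
apply: matching_like_pos_index => [|i j]; last first.
  by rewrite mxE oppr_eq0 adjmx_supp.
by rewrite raddfN map_mxN adjmx_herm.
Qed.

End GainGraph.

Theorem theorem3p1 (R : realType) (n : nat) (G : gain_graph R n)
    (G_conn : connected (ugraph G)) :
  ((matching_number (ugraph G))%:Z - cyclomatic (ugraph G)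
     <= (pos_inertia G)%:Z
     <= (matching_number (ugraph G))%:Z + cyclomatic (ugraph G))
  /\
  ((matching_number (ugraph G))%:Z - cyclomatic (ugraph G)
     <= (neg_inertia G)%:Z
     <= (matching_number (ugraph G))%:Z + cyclomatic (ugraph G)).
Proof.
set m := matching_number _; set c := cyclomatic _.
have bounds mu : matching_like (ugraph G) mu ->
    m%:Z - c <= (mu setT)%:Z <= m%:Z + c.
  move=> mu_like; have nu_like := matching_like_matching_number (ugraph G).
  rewrite /m -matching_number_inT lerBlDr.
  by apply/andP; split; apply: matching_like_diff.
have := bounds _ (matching_like_pos_inertia G).
have := bounds _ (matching_like_neg_inertia G).
by rewrite !mask_mx_setT -neg_inertiaE => -> ->.
Qed.
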